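(* Let $n=1$. Non-stationary iterations in the (spatially discretized) generalized MBO algorithm strictly decrease the value of $\tilde E^\tau$, and since the state space $\{\pm1\}^{|\tilde\Omega|}$ is finite, the algorithm converges in a finite number of iterations. Furthermore, for $m:=e^{-\|\tilde\Delta\|\tau}$, each (non-stationary) iteration reduces the value of $\tilde E^\tau$ by at least $2m$, so the total number of iterations is less than $\tilde E^\tau(A_0)/(2m)$.
   Context: $\Omega$ is a flat torus or, more generally, a closed manifold, $\tilde\Omega=\{x_i\}_{i=1}^{|\tilde\Omega|}\subset\Omega$ is a discrete grid, $\tilde\Delta$ is a standard finite difference approximation of the Laplacian on $\tilde\Omega$, with operator norm $\|\tilde\Delta\|$, and $\tau>0$ is a time step. The discrete functional $\tilde E^\tau:\ell^2(\tilde\Omega)\to\mathbb R$ is defined, with $f_i=f(x_i)$, by $$\tilde E^\tau(f)=\frac1\tau\sum_{x_i\in\tilde\Omega}\left(1-f_i\,(e^{\tilde\Delta\tau}f)_i\right).$$ For $n=1$ the orthogonal group is $O_1=\{\pm1\}$. The discretized generalized MBO algorithm starts from $A_0:\tilde\Omega\to\{\pm1\}$ and iterates two steps: given $A_s:\tilde\Omega\to\{\pm1\}$, compute $\tilde A=e^{\tilde\Delta\tau}A_s$ (diffusion step), and then set $A_{s+1}(x_i)$ to be the closest element of $\{\pm1\}$ to $\tilde A(x_i)$, i.e. the sign of $\tilde A(x_i)$ (projection step). An iteration is non-stationary if $A_{s+1}\ne A_s$.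
   Formalization: The 2m reduction and the count bound are false for large τ, so they are stated for τ ≤ 2, with 4m/τ in place of 2m for every τ > 0; the strict count bound assumes Ẽ^τ(A_0) > 0 (if it is 0, no non-stationary iteration occurs). Laplacians are symmetric, nonpositive and kill constants. *)

(* Defs.v *)
From HB Require Import structures.
From mathcomp Require Import all_boot all_order all_algebra all_fingroup.
From mathcomp Require Import all_classical all_reals all_analysis.
From mathcomp Require Import ring.

Set Implicit Arguments.
Unset Strict Implicit.
Unset Printing Implicit Defensive.

Import Order.TTheory GRing.Theory Num.Theory.
Import numFieldNormedType.Exports.
Local Open Scope classical_set_scope.
Local Open Scope ring_scope.

(* The grid is {x_i : i < N}; a grid function f is the column vector of the
   values f(x_i), and a linear operator on grid functions is an N x N matrix. *)

Definition l2dot (R : realType) (N : nat) (f g : 'cV[R]_N) : R :=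
  \sum_(i < N) f i 0 * g i 0.

Definition l2norm (R : realType) (N : nat) (f : 'cV[R]_N) : R :=
  Num.sqrt (l2dot f f).

Definition opnorm (R : realType) (N : nat) (L : 'M[R]_N) : R :=
  sup [set l2norm (L *m f) | f in [set f : 'cV[R]_N | l2norm f <= 1]].

Definition mxexp (R : realType) (N : nat) (L : 'M[R]_N) : 'M[R]_N :=
  limn (series (fun k : nat => k`!%:R^-1 *: L ^+ k)).

(* The class of finite difference Laplacians on a grid of a closed manifold:
   discrete counterparts of self-adjointness, nonpositivity, and vanishing on
   constants of the Laplace-Beltrami operator.  The usual (2d+1)-point scheme
   on a flat torus belongs to it, see [torus_laplacian_is_discrete_laplacian]. *)
Record discrete_laplacian (R : realType) (N : nat) (L : 'M[R]_N) : Prop :=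
  DiscreteLaplacian {
    dlap_sym : L^T = L;
    dlap_const : L *m const_mx 1 = 0 :> 'cV[R]_N;
    dlap_nonpos : forall f : 'cV[R]_N, l2dot f (L *m f) <= 0
  }.

Definition energy (R : realType) (N : nat) (L : 'M[R]_N) (tau : R)
    (f : 'cV[R]_N) : R :=
  tau^-1 * \sum_(i < N) (1 - f i 0 * (mxexp (tau *: L) *m f) i 0).

Definition O1 (R : realType) : set R := [set 1; -1].

Definition is_state (R : realType) (N : nat) (A : 'cV[R]_N) : Prop :=
  forall i, O1 (A i 0).

(* At a tie (x = 0) both elements of O1 qualify. *)
Definition closest_O1 (R : realType) (x b : R) : Prop :=
  O1 b /\ forall c, O1 c -> `|x - b| <= `|x - c|.

Definition mbo_step (R : realType) (N : nat) (L : 'M[R]_N) (tau : R)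
    (A A' : 'cV[R]_N) : Prop :=
  forall i, closest_O1 ((mxexp (tau *: L) *m A) i 0) (A' i 0).

Definition mbo_run (R : realType) (N : nat) (L : 'M[R]_N) (tau : R)
    (A : nat -> 'cV[R]_N) : Prop :=
  is_state (A 0%N) /\ forall s, mbo_step L tau (A s) (A s.+1).

Definition num_nonstationary (R : realType) (N : nat) (A : nat -> 'cV[R]_N)
    (S : nat) : nat :=
  (\sum_(s < S) (A s.+1 != A s))%N.

(* The (2d+1)-point Laplacian on a periodic rectangular grid with n k points
   and spacing h k in direction k. *)

Definition torus_grid (d : nat) (n : 'I_d -> nat) : finType :=
  {dffun forall k : 'I_d, 'I_(n k)}.

Definition torus_shift (d : nat) (n : 'I_d -> nat) (k : 'I_d)
    (x : torus_grid n) : torus_grid n :=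
  [ffun j => if j == k then ordS (x j) else x j].

Definition torus_shift_ord (d : nat) (n : 'I_d -> nat) (k : 'I_d)
    (i : 'I_#|torus_grid n|) : 'I_#|torus_grid n| :=
  enum_rank (torus_shift k (enum_val i)).

Lemma torus_shift_ord_inj (d : nat) (n : 'I_d -> nat) (k : 'I_d) :
  injective (@torus_shift_ord d n k).
Proof.
move=> i j /enum_rank_inj /ffunP E; apply/enum_val_inj/ffunP => l.
by have := E l; rewrite !ffunE; case: eqP => // _ /ordS_inj.
Qed.

Definition torus_shift_perm (d : nat) (n : 'I_d -> nat) (k : 'I_d) :
    {perm 'I_#|torus_grid n|} :=
  perm (@torus_shift_ord_inj d n k).

Definition torus_laplacian (R : realType) (d : nat) (n : 'I_d -> nat)
    (h : 'I_d -> R) : 'M[R]_#|torus_grid n| :=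
  \matrix_(i, j) \sum_(k < d) (h k ^+ 2)^-1 *
    ((j == torus_shift_perm n k i)%:R + (i == torus_shift_perm n k j)%:R
      - 2 * (i == j)%:R).

Lemma torus_laplacianE (R : realType) (d : nat) (n : 'I_d -> nat)
    (h : 'I_d -> R) (f : 'cV[R]_#|torus_grid n|) i :
  (torus_laplacian n h *m f) i 0 = \sum_(k < d) (h k ^+ 2)^-1 *
    (f (torus_shift_perm n k i) 0 + f ((torus_shift_perm n k)^-1%g i) 0
      - 2 * f i 0).
Proof.
rewrite mxE; under eq_bigr do rewrite mxE mulr_suml.
rewrite exchange_big /=; apply: eq_bigr => k _.
under eq_bigr do rewrite -mulrA mulrBl mulrDl -mulrA.
rewrite -mulr_sumr sumrB big_split /= -mulr_sumr.
set p := torus_shift_perm n k.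
have sel (g : 'I_#|torus_grid n|) :
    \sum_j (j == g)%:R * f j 0 = f g 0.
  rewrite (bigD1 g) //= eqxx mul1r big1 ?addr0 // => j /negPf ->.
  by rewrite mul0r.
congr (_ * (_ + _ - 2 * _)); rewrite -?sel //; apply: eq_bigr => j _.
  congr (_%:R * _); congr nat_of_bool.
  by apply/eqP/eqP => [-> | ->]; rewrite ?permK ?permKV.
by congr (_%:R * _); congr nat_of_bool; apply/eqP/eqP => ->.
Qed.

Lemma torus_laplacian_is_discrete_laplacian (R : realType) (d : nat)
    (n : 'I_d -> nat) (h : 'I_d -> R) :
  discrete_laplacian (torus_laplacian n h).
Proof.
split.
- apply/matrixP => i j; rewrite !mxE; apply: eq_bigr => k _.
  by rewrite [in (j == i)]eq_sym [X in X - _]addrC.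
- apply/colP => i; rewrite torus_laplacianE [RHS]mxE big1 // => k _.
  by rewrite !mxE mulr1 subrr mulr0.
- move=> f; rewrite /l2dot; under eq_bigr do rewrite torus_laplacianE mulr_sumr.
  rewrite exchange_big /=; apply: sumr_le0 => k _.
  set p := torus_shift_perm n k.
  under eq_bigr do rewrite mulrCA.
  rewrite -mulr_sumr mulr_ge0_le0 ?invr_ge0 ?sqr_ge0 //.
  set F := fun i => f i 0.
  suff -> : \sum_i F i * (F (p i) + F (p^-1%g i) - 2 * F i)
          = - \sum_i (F (p i) - F i) ^+ 2.
    by rewrite oppr_le0 sumr_ge0 // => i _; rewrite sqr_ge0.
  have -> : \sum_i F i * (F (p i) + F (p^-1%g i) - 2 * F i)
     = \sum_i F i * F (p i) + \sum_i F i * F (p^-1%g i)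
       - (\sum_i F i ^+ 2 + \sum_i F i ^+ 2).
    rewrite -!big_split -sumrB /=; apply: eq_bigr => i _.
    by rewrite mulrBr mulrDr mulrCA -expr2 mulr_natl mulr2n.
  rewrite [X in _ + X - _](reindex_inj (@perm_inj _ p)) /=.
  rewrite [X in _ - (X + _)](reindex_inj (@perm_inj _ p)) /=.
  rewrite -!big_split -sumrB -sumrN /=; apply: eq_bigr => i _.
  by rewrite permK sqrrB [F (p i) * F i]mulrC mulr2n !opprD !opprK; ring.
Qed.

(* Main.v *)
Require Import Defs.
From HB Require Import structures.
From mathcomp Require Import all_boot all_order all_algebra all_fingroup.
From mathcomp Require Import all_classical all_reals all_analysis.
From mathcomp Require Import complex ring lra.

Import Order.TTheory GRing.Theory Num.Theory.
Import numFieldNormedType.Exports.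
Local Open Scope classical_set_scope.
Local Open Scope ring_scope.

(** Write P = exp(tau L), D = A' - A.  Since P is symmetric,
    tau (E A - E A') = 2 <D, P A> + <D, P D>.  The first term is nonnegative
    because D is zero or has the sign of P A at each grid point; the second is
    at least m |D|^2 >= 4 m, the spectrum of P lying in [m, 1].  If the total
    were exactly 4 m, then P D = m D and <D, P A> = m <D, A> = - m |D|^2 / 2 < 0,
    a contradiction; so every drop is strictly larger than 4 m / tau.  Since
    E >= 0 on states, the number of non-stationary steps is bounded. *)

(** * Real spectral theorem, and the matrix exponential in an eigenframe *)

(* The rows of V are the real and imaginary parts of a unitary eigenbasis, hence
   possibly zero: the real spectral theorem is only needed up to a tight frame. *)
Lemma symmetric_eigenframe {R : rcfType} {N : nat} {L : 'M[R]_N} : L^T = L ->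
  exists p (V : 'M[R]_(p, N)) (d : 'rV[R]_p),
    V^T *m V = 1%:M /\ V *m L = diag_mx d *m V.
Proof.
move=> Lsym; pose Lc : 'M[R[i]]_N := map_mx (real_complex R) L.
have Lherm : Lc \is hermsymmx.
  apply/is_hermitianmxP; rewrite expr0 scale1r; apply/matrixP => i j.
  rewrite !mxE -[in LHS]Lsym mxE; apply/esym/CrealP/complex_realP.
  by exists (L j i).
have /orthomx_spectralP Lspec := hermitian_normalmx Lherm.
have /mxOverP dreal := hermitian_spectral_diag_real Lherm.
have Uunit := spectral_unit Lc.
have Uinv := invmx_unitary (spectral_unitarymx Lc).
move: Lspec dreal Uunit Uinv.
set U := spectralmx Lc; set D := spectral_diag Lc => Lspec dreal Uunit Uinv.
have UL : U *m Lc = diag_mx D *m U by rewrite {1}Lspec !mulmxA mulmxV ?mul1mx.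
have UU := mulVmx Uunit; rewrite Uinv in UU.
have ReD x y : complex.Re (x + y) = complex.Re x + complex.Re y :> R.
  by case: x y => [a b] [].
have ImD x y : complex.Im (x + y) = complex.Im x + complex.Im y :> R.
  by case: x y => [a b] [].
have Re_sum := big_morph (@complex.Re R) ReD erefl.
have Im_sum := big_morph (@complex.Im R) ImD erefl.
(* Eigenvalues of a Hermitian matrix are real, so multiplication by [D] commutes with taking real
   and imaginary parts. *)
have DE l : D 0 l = real_complex R (complex.Re (D 0 l)).
  by rewrite RRe_real // dreal.
pose d := map_mx (@complex.Re R) D.
exists (N + N)%N, (col_mx (map_mx (@complex.Re R) U) (map_mx (@complex.Im R) U)),
  (row_mx d d); split.
- rewrite tr_col_mx mul_row_col; apply/matrixP => i j.
  (* The real part of [U^* U = 1] says that the Gram matrices of the real and imaginary parts of [U]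
     add up to the identity. *)
  have := congr1 (@complex.Re R) (congr1 (fun M : 'M[_]_N => M i j) UU).
  have -> : complex.Re ((1%:M : 'M[R[i]]_N) i j) = (1%:M : 'M[R]_N) i j.
    by rewrite !mxE; case: eqP.
  move=> <-; rewrite !mxE Re_sum -big_split /=.
  apply: eq_bigr => k _; rewrite !mxE /=.
  by case: (U k i) (U k j) => [a b] [a' b'] /=; ring.
- rewrite mul_col_mx diag_mx_row mul_block_col !mul0mx addr0 add0r.
  have ULE i j : \sum_k U i k * real_complex R (L k j)
      = real_complex R (complex.Re (D 0 i)) * U i j.
    have E : (diag_mx D *m U) i j = D 0 i * U i j.
      by rewrite [diag_mx D *m U]mul_diag_mx mxE.
    rewrite -DE -E -UL mxE; apply: eq_bigr => k _.
    by rewrite mxE.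
  congr col_mx; apply/matrixP => i j; rewrite mul_diag_mx !mxE.
  + transitivity (complex.Re (real_complex R (complex.Re (D 0 i)) * U i j)).
      rewrite -ULE Re_sum; apply: eq_bigr => k _; rewrite !mxE /=.
      by case: (U i k) => [a b] /=; ring.
    by case: (U i j) => [a b] /=; ring.
  + transitivity (complex.Im (real_complex R (complex.Re (D 0 i)) * U i j)).
      rewrite -ULE Im_sum; apply: eq_bigr => k _; rewrite !mxE /=.
      by case: (U i k) => [a b] /=; ring.
    by case: (U i j) => [a b] /=; ring.
Qed.

Lemma cvg_mx {R : realType} {m n : nat} {T : Type} {F : set_system T}
    (FF : Filter F) (M : T -> 'M[R]_(m, n)) (A : 'M[R]_(m, n)) :
  (forall i j, M x i j @[x --> F] --> A i j) -> M x @[x --> F] --> A.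
Proof.
move=> MA; apply/cvg_ballP => e e0.
have : \forall x \near F, forall ij, ball (A ij.1 ij.2) e (M x ij.1 ij.2).
  by apply: filter_forall => -[i j]; apply: (cvg_ball (MA i j)).
by apply: filterS => x Hx; split => // i j; exact: (Hx (i, j)).
Qed.

Section eigenframe.
Context {R : realType} {N p : nat} {L : 'M[R]_N}.
Context {V : 'M[R]_(p, N)} {d : 'rV[R]_p}.
Hypotheses (VV : V^T *m V = 1%:M) (VL : V *m L = diag_mx d *m V).

Lemma exprmx_eigenframe k :
  L ^+ k = V^T *m diag_mx (map_mx (fun x => x ^+ k) d) *m V.
Proof.
(* [V *m V^T] may differ from the identity, so the induction is on the intertwining relation; [V^T]
   enters only at the end. *)
suff VLk : V *m L ^+ k = diag_mx (map_mx (fun x => x ^+ k) d) *m V.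
  by rewrite -mulmxA -VLk mulmxA VV mul1mx.
elim: k => [|k IH].
  rewrite expr0 mulmx1; apply/matrixP => i j; rewrite mul_diag_mx !mxE expr0.
  by rewrite mul1r.
rewrite exprSr mulmxA IH -mulmxA VL mulmxA mulmx_diag.
by congr (diag_mx _ *m _); apply/rowP => j; rewrite !mxE exprSr.
Qed.

(** Each entry of the partial sums is a fixed finite combination of partial sums of scalar
    exponentials, which converge. *)
Lemma mxexp_eigenframe : mxexp L =
  V^T *m diag_mx (map_mx (@expR R) d) *m V.
Proof.
rewrite /mxexp; apply/cvg_lim => //=.
apply: cvg_mx => i j.
have entry (h : R -> R) : (V^T *m diag_mx (map_mx h d) *m V) i j
    = \sum_(l < p) V l i * V l j * h (d 0 l).
  rewrite mxE; apply: eq_bigr => l _.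
  by rewrite mul_mx_diag !mxE mulrAC.
rewrite entry.
rewrite [X in X @ _ --> _](_ : _ = fun n => \sum_(l < p)
    V l i * V l j * series (exp_coeff (d 0 l)) n); last first.
  apply/funext => n; rewrite /series /= summxE.
  rewrite (eq_bigr (fun k => k`!%:R^-1 * (L ^+ k) i j)); last first.
    by move=> k _; exact: mxE.
  under eq_bigr do rewrite exprmx_eigenframe entry.
  under [in RHS]eq_bigr do rewrite mulr_sumr.
  rewrite [RHS]exchange_big /=; apply: eq_bigr => k _; rewrite mulr_sumr.
  by apply: eq_bigr => l _; rewrite /exp_coeff /=; ring.
apply: cvg_big => [|l _]; first exact: add_continuous.
by apply: cvgMl_tmp; exact: is_cvg_series_exp_coeff.
Qed.
End eigenframe.

(** * Discrete inner product and operator norm *)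

Lemma l2dotE {R : realType} {N : nat} (f g : 'cV[R]_N) :
  l2dot f g = (f^T *m g) 0 0.
Proof. by rewrite mxE; apply: eq_bigr => i _; rewrite mxE. Qed.

Lemma l2dotZ {R : realType} {N : nat} (a b : R) (f g : 'cV[R]_N) :
  l2dot (a *: f) (b *: g) = a * b * l2dot f g.
Proof. by rewrite /l2dot mulr_sumr; apply: eq_bigr => i _; rewrite !mxE mulrACA. Qed.

Lemma l2dot_ge0 {R : realType} {N : nat} (f : 'cV[R]_N) : 0 <= l2dot f f.
Proof. by apply: sumr_ge0 => i _; rewrite -expr2 sqr_ge0. Qed.

Lemma l2dot_gt0 {R : realType} {N : nat} {f : 'cV[R]_N} :
  f != 0 -> 0 < l2dot f f.
Proof.
move=> f0; rewrite lt_def l2dot_ge0 andbT; apply: contraNneq f0 => f0.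
apply/eqP/colP => i; apply/eqP; rewrite !mxE -sqrf_eq0 expr2.
by apply/eqP; apply: (psumr_eq0P _ f0) => // j _; rewrite -expr2 sqr_ge0.
Qed.

(** Needed because [sup] dominates its set only when that set is bounded. On the unit ball every
    [|f j 0| <= 1], so the absolute row sums of [L] give a bound. *)
Lemma opnorm_has_ubound {R : realType} {N : nat} (L : 'M[R]_N) :
  has_ubound [set l2norm (L *m f) | f in [set f : 'cV[R]_N | l2norm f <= 1]].
Proof.
exists (Num.sqrt (\sum_i (\sum_j `|L i j|) ^+ 2)) => _ [f f1 <-].
apply: ler_wsqrtr; apply: ler_sum => i _; rewrite -expr2.
rewrite -real_normK ?num_real // ler_sqr ?nnegrE ?sumr_ge0 //.
rewrite mxE; apply: le_trans (ler_norm_sum _ _ _) _; apply: ler_sum => j _.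
rewrite normrM ler_piMr //.
rewrite -(@ler_sqr R) ?nnegrE // expr1n real_normK ?num_real //.
have : l2dot f f <= 1.
  by rewrite -(sqr_sqrtr (l2dot_ge0 f)) -[1](expr1n R 2) ler_sqr ?nnegrE ?sqrtr_ge0.
apply: le_trans; rewrite /l2dot (bigD1 j) //= -expr2 lerDl.
by apply: sumr_ge0 => k _; rewrite -expr2 sqr_ge0.
Qed.

(** The normalized eigenvector competes in the supremum. *)
Lemma eigenvalue_le_opnorm {R : realType} {N : nat} {L : 'M[R]_N}
    {v : 'cV[R]_N} {a : R} : v != 0 -> L *m v = a *: v -> `|a| <= opnorm L.
Proof.
move=> v0 Lv; have nv0 : 0 < l2norm v by rewrite sqrtr_gt0 l2dot_gt0.
have normZ b (f : 'cV[R]_N) : l2norm (b *: f) = `|b| * l2norm f.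
  by rewrite /l2norm l2dotZ sqrtrM -expr2 ?sqr_ge0 // sqrtr_sqr.
have u1 : l2norm ((l2norm v)^-1 *: v) = 1.
  by rewrite normZ gtr0_norm ?invr_gt0 // mulVf ?gt_eqF.
apply: (ub_le_sup (opnorm_has_ubound L)).
exists ((l2norm v)^-1 *: v); first by rewrite /= u1.
by rewrite -scalemxAr Lv scalerA mulrC -scalerA normZ u1 mulr1.
Qed.

(** * Spectral bounds for the heat operator *)

Section heat_semigroup.
Context {R : realType} {N : nat} {L : 'M[R]_N} {tau : R}.
Hypotheses (hL : discrete_laplacian L) (htau : 0 < tau).

Let P := mxexp (tau *: L).
Let m := expR (- (opnorm L * tau)).

(** Here [e l] is the exponential of [tau] times an eigenvalue: nonpositivity of [L] bounds it above
    by 1, the operator norm bounds it below by [m]. A zero row of [V] says nothing about its [e l],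
    hence the condition on the coordinate. *)
Lemma heat_eigenframe : exists p (V : 'M[R]_(p, N)) (e : 'I_p -> R),
  [/\ forall f g : 'cV[R]_N, l2dot f g = \sum_l (V *m f) l 0 * (V *m g) l 0,
      forall f g : 'cV[R]_N, l2dot f (P *m g)
        = \sum_l e l * ((V *m f) l 0 * (V *m g) l 0) &
      forall (f : 'cV[R]_N) l, (V *m f) l 0 != 0 -> m <= e l <= 1].
Proof.
have [p [V [d [VV VL]]]] := symmetric_eigenframe (dlap_sym hL).
have VtL : V *m (tau *: L) = diag_mx (tau *: d) *m V.
  rewrite -scalemxAr VL scalemxAl; congr (_ *m _); apply/matrixP => i j.
  by rewrite !mxE mulrnAr.
have PE := mxexp_eigenframe VV VtL.
exists p, V, (fun l => expR (tau * d 0 l)); split.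
- move=> f g; rewrite l2dotE -[in LHS](mul1mx g) -VV !mulmxA -trmx_mul -mulmxA.
  by rewrite mxE; apply: eq_bigr => l _; rewrite mxE.
- move=> f g; rewrite l2dotE /P PE !mulmxA -trmx_mul -mulmxA mxE.
  by apply: eq_bigr => l _; rewrite mul_mx_diag !mxE; ring.
- move=> f l Vf.
  have v0 : (row l V)^T != 0.
    apply: contraNneq Vf => /colP v0; rewrite mxE big1 // => k _.
    by have := v0 k; rewrite !mxE => ->; rewrite mul0r.
  (* Symmetry of [L] turns the row, a left eigenvector, into a right one. *)
  have Lv : L *m (row l V)^T = d 0 l *: (row l V)^T.
    rewrite -{1}(dlap_sym hL) -trmx_mul -row_mul VL; apply/colP => i.
    by rewrite mul_diag_mx !mxE.
  have dnorm := eigenvalue_le_opnorm v0 Lv.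
  have d0 : d 0 l <= 0.
    have := dlap_nonpos hL (row l V)^T.
    by rewrite Lv -[X in l2dot X]scale1r l2dotZ mul1r pmulr_lle0 ?l2dot_gt0.
  rewrite /m ler_expR expR_le1 pmulr_rle0 // d0 andbT.
  rewrite lerNl -mulrN [leRHS]mulrC ler_pM2l // (le_trans _ dnorm) //.
  by rewrite -normrN ler_norm.
Qed.

Lemma heat_sym f g : l2dot f (P *m g) = l2dot g (P *m f).
Proof.
have [p [V [e [_ VP _]]]] := heat_eigenframe.
by rewrite !VP; apply: eq_bigr => l _; congr (_ * _); rewrite mulrC.
Qed.

Lemma heat_le f : l2dot f (P *m f) <= l2dot f f.
Proof.
have [p [V [e [dotE VP eb]]]] := heat_eigenframe.
rewrite VP dotE; apply: ler_sum => l _.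
have [->|/eb/andP[_ e1]] := eqVneq ((V *m f) l 0) 0; first by rewrite !mulr0.
by rewrite ler_piMl // -expr2 sqr_ge0.
Qed.

Let heat_gap (f : 'cV[R]_N) p (V : 'M[R]_(p, N)) (e : 'I_p -> R) :
  (forall (f : 'cV[R]_N) l, (V *m f) l 0 != 0 -> m <= e l <= 1) ->
  forall k, 0 <= (e k - m) * ((V *m f) k 0 * (V *m f) k 0).
Proof.
move=> eb k; have [->|/eb/andP[me _]] := eqVneq ((V *m f) k 0) 0.
  by rewrite !mulr0.
by rewrite mulr_ge0 ?subr_ge0 // -expr2 sqr_ge0.
Qed.

Lemma heat_ge f : m * l2dot f f <= l2dot f (P *m f).
Proof.
have [p [V [e [dotE VP eb]]]] := heat_eigenframe.
rewrite VP dotE mulr_sumr; apply: ler_sum => l _.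
by rewrite -subr_ge0 -mulrBl heat_gap.
Qed.

(** Equality kills every nonnegative term [(e l - m) (V f)_l^2], so [f] lives on coordinates with
    [e l = m]. This is [P f = m f], tested against [g]. *)
Lemma heat_ge_eq f g : l2dot f (P *m f) = m * l2dot f f ->
  l2dot f (P *m g) = m * l2dot f g.
Proof.
have [p [V [e [dotE VP eb]]]] := heat_eigenframe.
rewrite !VP !dotE !mulr_sumr => /eqP; rewrite -subr_eq0 -sumrB.
under eq_bigr do rewrite -mulrBl.
move=> /eqP fm; apply: eq_bigr => l _.
have /eqP : (e l - m) * ((V *m f) l 0 * (V *m f) l 0) = 0.
  by apply: (psumr_eq0P _ fm) => // k _; exact: heat_gap.
rewrite !mulf_eq0 subr_eq0 orbb => /orP[/eqP -> //|/eqP ->].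
by rewrite !mul0r !mulr0.
Qed.
End heat_semigroup.

(** * Energy, states and the projection step *)

Lemma energyE {R : realType} {N : nat} (L : 'M[R]_N) (tau : R) (f : 'cV[R]_N) :
  energy L tau f = tau^-1 * (N%:R - l2dot f (mxexp (tau *: L) *m f)).
Proof. by rewrite /energy sumrB sumr_const card_ord. Qed.

Lemma state_l2dot {R : realType} {N : nat} {A : 'cV[R]_N} :
  is_state A -> l2dot A A = N%:R.
Proof.
move=> sA; rewrite /l2dot -[in RHS](card_ord N) -sumr_const.
by apply: eq_bigr => i _; case: (sA i) => ->; rewrite ?mulrNN mulr1.
Qed.

Lemma finite_states (R : realType) (N : nat) :
  finite_set [set A : 'cV[R]_N | is_state A].
Proof.
pose col (b : {ffun 'I_N -> bool}) : 'cV[R]_N := \col_i (-1) ^+ b i.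
apply: (@sub_finite_set _ _ [set col b | b in setT]); last first.
  exact/finite_image/finite_finset.
move=> A sA; exists [ffun i => A i 0 == -1] => //.
apply/colP => i; rewrite !mxE ffunE; case: (sA i) => -> /=.
  by rewrite -subr_eq0 opprK -[1 + 1]/(2%:R) pnatr_eq0.
by rewrite eqxx.
Qed.

(** Comparison with the competitor [- b] gives [(x - b)^2 <= (x + b)^2], that is [0 <= 4 b x], ties
    included. *)
Lemma closest_O1_ge0 {R : realType} {x b : R} : closest_O1 x b -> 0 <= b * x.
Proof.
have norm_le (y z : R) : `|y| <= `|z| -> y ^+ 2 <= z ^+ 2.
  by rewrite -(ler_sqr (normr_nneg y) (normr_nneg z)) !real_normK ?num_real.
case=> -[-> /(_ (-1) (or_intror erefl))|-> /(_ 1 (or_introl erefl))] /norm_le; lra.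
Qed.

(** * Energy drop in one iteration *)

Section mbo.
Context {R : realType} {N : nat} {L : 'M[R]_N} {tau : R}.
Hypotheses (hL : discrete_laplacian L) (htau : 0 < tau).

Let P := mxexp (tau *: L).
Let E := energy L tau.
Let m := expR (- (opnorm L * tau)).

Lemma energy_ge0 A : is_state A -> 0 <= E A.
Proof.
move=> sA; rewrite /E energyE mulr_ge0 ?invr_ge0 ?(ltW htau) // subr_ge0.
by rewrite -(state_l2dot sA) heat_le.
Qed.

Lemma mbo_step_state A A' : mbo_step L tau A A' -> is_state A'.
Proof. by move=> st i; case: (st i). Qed.

Lemma mbo_step_energy A A' : is_state A -> mbo_step L tau A A' -> A' <> A ->
  E A' < E A - 4 * m / tau.
Proof.
move=> sA st neqA; have sA' := mbo_step_state _ _ st; pose D := A' - A.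
(* Where the sign flips, [D i 0 = 2 * A' i 0], so the projection makes the product nonnegative;
   elsewhere it is zero. *)
have entries i : [/\ A' i 0 = A i 0 \/ A' i 0 = - A i 0, A i 0 ^+ 2 = 1
    & 0 <= D i 0 * (P *m A) i 0].
  have := closest_O1_ge0 (st i); rewrite -/P [D i 0]mxE [(- A) i 0]mxE.
  move: ((P *m A) i 0) => x; case: (sA i) (sA' i) => -> [] -> Ax;
    by split; [rewrite ?opprK; auto | rewrite ?sqrrN expr1n | lra].
have DPA : 0 <= l2dot D (P *m A).
  by apply: sumr_ge0 => i _; case: (entries i).
(* At a flipped point [D = - 2 A] and [A^2 = 1], so both summands equal -2. *)
have DA : l2dot D A = - (l2dot D D / 2).
  rewrite /l2dot mulr_suml -sumrN; apply: eq_bigr => i _.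
  by case: (entries i) => -[] AA A1 _; rewrite !mxE AA; field.
(* A single changed entry jumps by 2 in absolute value and already contributes 4. *)
have DD : 4 <= l2dot D D.
  have [i Di] : exists i, A' i 0 != A i 0.
    apply: contra_notP neqA => /forallNP AA; apply/colP => i.
    by apply/eqP; apply/negP => /negP /AA.
  rewrite /l2dot (bigD1 i) //=; apply: ler_wpDr.
    by apply: sumr_ge0 => k _; rewrite -expr2 sqr_ge0.
  case: (entries i) Di => -[->|]; first by rewrite eqxx.
  move=> AA A1 _ _; have -> : D i 0 = - 2 * A i 0 by rewrite !mxE AA; ring.
  by rewrite mulrACA -[X in _ * X]expr2 A1; lra.
have m0 : 0 < m := expR_gt0 _.
have DPD := heat_ge hL htau D.
have lt4 : 4 * m < 2 * l2dot D (P *m A) + l2dot D (P *m D).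
  have le4 : 4 * m <= m * l2dot D D by rewrite mulrC ler_pM2l.
  rewrite lt_neqAle; apply/andP; split; last by move: DPD; rewrite -/P -/m; lra.
  apply/eqP => eq4.
  (* Equality collapses the chain [4 m <= m |D|^2 <= <D, P D> <= 2 <D, P A> + <D, P D>]. *)
  have eqD : l2dot D (P *m D) = m * l2dot D D by move: DPD; rewrite -/P -/m; lra.
  have := heat_ge_eq hL htau D A eqD; rewrite -/P -/m DA.
  have : 0 < m * (l2dot D D / 2) by apply: mulr_gt0 => //; lra.
  by rewrite mulrN; lra.
have A'E : l2dot A' (P *m A') = l2dot A (P *m A)
    + (2 * l2dot D (P *m A) + l2dot D (P *m D)).
  have l2dotD (f g h : 'cV[R]_N) : l2dot (f + g) h = l2dot f h + l2dot g h.
    by rewrite !l2dotE raddfD mulmxDl mxE.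
  have l2dotC (f g : 'cV[R]_N) : l2dot f g = l2dot g f.
    by apply: eq_bigr => i _; rewrite mulrC.
  have -> : A' = A + D by rewrite addrC subrK.
  have symAD : l2dot A (P *m D) = l2dot D (P *m A) := heat_sym hL htau A D.
  clearbody D; rewrite mulmxDr l2dotD ![l2dot _ (P *m A + P *m D)]l2dotC !l2dotD.
  by rewrite ![l2dot (P *m _) _]l2dotC symAD; ring.
rewrite /E !energyE -/P A'E mulrC [X in _ < X - _]mulrC -mulrBl ltr_pM2r ?invr_gt0 //; lra.
Qed.
End mbo.

(** * Counting the moves of a descending sequence *)

Section descent.
Context {R : realType} {N : nat} {A : nat -> 'cV[R]_N} {E : 'cV[R]_N -> R}.
Context {delta : R}.
Hypotheses (delta0 : 0 < delta) (E0 : forall s, 0 <= E (A s)).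
Hypothesis descent :
  forall s, A s.+1 <> A s -> E (A s.+1) < E (A s) - delta.

Let num_nonstationaryS S : num_nonstationary A S.+1 =
  (num_nonstationary A S + (A S.+1 != A S))%N.
Proof. by rewrite /num_nonstationary big_ord_recr. Qed.

(** The strict bound fails while nothing has moved, so that case is kept apart; the first move makes
    the inequality strict. *)
Lemma descent_energy S :
  num_nonstationary A S = 0%N /\ A S = A 0%N \/
  E (A S) + (num_nonstationary A S)%:R * delta < E (A 0%N).
Proof.
elim: S => [|S IH]; first by left; rewrite /num_nonstationary big_ord0.
rewrite num_nonstationaryS; have [->|/eqP neqA] := eqVneq (A S.+1) (A S).
  by rewrite addn0.
right; move: IH (descent _ neqA); rewrite natrD mulrDl mul1r.
by case=> [[-> ->]|]; lra.
Qed.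

Lemma descent_count S : 0 < E (A 0%N) ->
  (num_nonstationary A S)%:R < E (A 0%N) / delta.
Proof.
(* With no move so far, the claim is just positivity of [E (A 0%N) / delta]. *)
move=> EA0; have [[-> _]|] := descent_energy S; first exact: divr_gt0.
by move: (E0 S); rewrite ltr_pdivlMr //; lra.
Qed.

(* At a tie a stationary step may be followed by a non-stationary one, so
   stabilization comes from the bounded count, not from the first A_(s+1) = A_s. *)
Lemma descent_stationary : exists S, forall s, (S <= s)%N -> A s = A S.
Proof.
pose K := Num.bound (E (A 0%N) / delta).
have count_le S : (num_nonstationary A S <= K)%N.
  have [[-> _]//|AS] := descent_energy S.
  rewrite -(ler_nat R) ltW // (lt_trans _ (archi_boundP _)) ?divr_ge0
    ?(ltW delta0) //.
  by move: (E0 S) AS; rewrite ltr_pdivlMr //; lra.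
pose attained k := `[< exists S, num_nonstationary A S = k >].
have ex0 : exists k, attained k.
  by exists (num_nonstationary A 0); apply/asboolP; exists 0%N.
have le_K k : attained k -> (k <= K)%N by move=> /asboolP[S <-].
(* [S] is a time at which the count attains its maximum; any later move would exceed it. *)
case: (ex_maxnP ex0 le_K) => k /asboolP[S Sk] kmax; exists S => s /subnKC <-.
elim: (s - S)%N => [|j IH]; first by rewrite addn0.
rewrite addnS -IH; apply/eqP/negPn/negP => neqA.
have mono : (num_nonstationary A S <= num_nonstationary A (S + j))%N.
  elim: (j) => [|i IHi]; first by rewrite addn0.
  by rewrite addnS num_nonstationaryS (leq_trans IHi) ?leq_addr.
have /kmax : attained (num_nonstationary A (S + j).+1).
  by apply/asboolP; exists (S + j).+1.
by rewrite num_nonstationaryS neqA addn1 -Sk ltnNge mono.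
Qed.
End descent.

Theorem proposition4p4 (R : realType) (N : nat) (L : 'M[R]_N) (tau : R)
    (hL : discrete_laplacian L) (htau : 0 < tau) :
  let E := energy L tau in
  let m := expR (- (opnorm L * tau)) in
  (* non-stationary iterations strictly decrease the energy *)
  (forall A A' : 'cV[R]_N, is_state A -> mbo_step L tau A A' -> A' <> A ->
     E A' < E A) /\
  (* the state space is finite and the algorithm converges in finitely many
     iterations *)
  finite_set [set A : 'cV[R]_N | is_state A] /\
  (forall A : nat -> 'cV[R]_N, mbo_run L tau A ->
     exists S : nat, forall s : nat, (S <= s)%N -> A s = A S) /\
  (* for tau <= 2: each non-stationary iteration reduces the energy by at
     least 2m, and the number of such iterations is less than E(A_0)/(2m) *)
  (tau <= 2 ->
     (forall A A' : 'cV[R]_N, is_state A -> mbo_step L tau A A' -> A' <> A ->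
        E A' <= E A - 2 * m) /\
     (forall A : nat -> 'cV[R]_N, mbo_run L tau A -> 0 < E (A 0%N) ->
        forall S : nat, (num_nonstationary A S)%:R < E (A 0%N) / (2 * m))) /\
  (* for every tau: the same with 4m/tau in place of 2m *)
  (forall A A' : 'cV[R]_N, is_state A -> mbo_step L tau A A' -> A' <> A ->
     E A' <= E A - 4 * m / tau) /\
  (forall A : nat -> 'cV[R]_N, mbo_run L tau A -> 0 < E (A 0%N) ->
     forall S : nat, (num_nonstationary A S)%:R < E (A 0%N) / (4 * m / tau)) /\
  (* the degenerate case E(A_0) = 0, where no strict bound is possible *)
  (forall A : nat -> 'cV[R]_N, mbo_run L tau A -> E (A 0%N) = 0 ->
     forall s : nat, A s = A 0%N).
Proof.
move=> E m.
have delta0 : 0 < 4 * m / tau by rewrite divr_gt0 ?mulr_gt0 ?expR_gt0.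
have step A A' : is_state A -> mbo_step L tau A A' -> A' <> A ->
  E A' < E A - 4 * m / tau := mbo_step_energy hL htau A A'.
have run_state A : mbo_run L tau A -> forall s, is_state (A s).
  by case=> A0 Astep [//|s]; exact: mbo_step_state (Astep s).
have run_ge0 A : mbo_run L tau A -> forall s, 0 <= E (A s).
  by move=> Arun s; apply: energy_ge0 => //; exact: run_state.
have run_descent A : mbo_run L tau A -> forall s, A s.+1 <> A s ->
    E (A s.+1) < E (A s) - 4 * m / tau.
  by move=> Arun s; apply: step; [exact: run_state|case: Arun].
have run_count A : mbo_run L tau A -> 0 < E (A 0%N) ->
    forall S, (num_nonstationary A S)%:R < E (A 0%N) / (4 * m / tau).
  move=> Arun EA0 S.
  exact: (descent_count delta0 (run_ge0 _ Arun) (run_descent _ Arun)).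
do 3?split.
- by move=> A A' sA st /(step _ _ sA st); lra.
- exact: finite_states.
- move=> A Arun.
  exact: (descent_stationary delta0 (run_ge0 _ Arun) (run_descent _ Arun)).
split=> [tau2|].
  (* [tau <= 2] is what makes the drop [4 * m / tau] at least [2 * m]. *)
  have le_delta : 2 * m <= 4 * m / tau.
    by rewrite ler_pdivlMr //; have := expR_gt0 (- (opnorm L * tau)); rewrite -/m; nra.
  split=> [A A' sA st /(step _ _ sA st)|A Arun EA0 S]; first by lra.
  apply: lt_le_trans (run_count A Arun EA0 S) _.
  by rewrite ler_pM2l // lef_pV2 // posrE mulr_gt0 ?expR_gt0.
split=> [A A' sA st neqA|]; first exact/ltW/step.
split=> // A Arun EA0; elim=> // s IH.
(* A first move away from zero energy would make the energy negative. *)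
apply/eqP/negPn/negP => /eqP neqA; have := run_ge0 A Arun s.+1.
rewrite -IH in neqA; have := run_descent A Arun s neqA; rewrite IH EA0; lra.
Qed.
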